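(* Let $f:\mathbb{N}\to\mathbb{R}_+$ satisfy $f(0)\geq 1$, and suppose that $f(n)^2>f(n-1)f(n+1)$ for every positive integer $n$. Then $f(a)f(b)>f(a+b)$ for all positive integers $a$ and $b$.
   Context: $\mathbb{N}$ denotes the set of non-negative integers and $\mathbb{R}_+=(0,+\infty)$. *)

(* Defs.v *)
From Stdlib Require Export Reals.

(* Main.v *)
Require Import Defs.
From Stdlib Require Import Reals Lra Lia.
Open Scope R_scope.

(** Strict log-concavity says that the ratios [f (n + 1) / f n] strictly
    decrease.  Hence [f (a + b) / f b], a product of [a] consecutive ratios
    starting at [b > 0], is smaller than [f a / f 0], so
    [f 0 * f (a + b) < f a * f b], and [f 0 >= 1] concludes. *)

Section StrictLogConcave.

Variable f : nat -> R.
Hypothesis f_pos : forall n, 0 < f n.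
Hypothesis f_logconcave : forall n, f n * f (S (S n)) < f (S n) * f (S n).

(** Ratios are compared in cross-multiplied form. The gap is [S k] because at gap zero both sides
    agree and strictness fails. *)
Lemma succ_ratio_decreasing (n k : nat) :
  f n * f (S (S k + n)) < f (S n) * f (S k + n)%nat.
Proof.
induction k as [|k IH]; [apply f_logconcave|].
assert (H := f_logconcave (S k + n)).
change (S (S k) + n)%nat with (S (S k + n)).
set (m := (S k + n)%nat) in *.
(* After scaling by [f m], [H] times [f n] and [IH] times [f (S m)] chain through
   [f n * f (S m) * f (S m)]. *)
apply (Rmult_lt_reg_r (f m)); [apply f_pos|].
assert (Hn := Rmult_lt_compat_l _ _ _ (f_pos n) H).
assert (Hm := Rmult_lt_compat_r _ _ _ (f_pos (S m)) IH).
lra.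
Qed.

(** Induction on [b]: each increment multiplies the left side by the ratio at [S a + S b] and the
    right side by the larger ratio at [S b]. The base case compares the ratios at [S a] and [0]. *)
Lemma strict_submultiplicative (a b : nat) :
  f 0%nat * f (S a + S b)%nat < f (S a) * f (S b).
Proof.
induction b as [|b IH].
- assert (H := succ_ratio_decreasing 0 a).
  replace (S a + 1)%nat with (S (S a + 0)) by lia.
  replace (S a + 0)%nat with (S a) in * by lia.
  lra.
- assert (H := succ_ratio_decreasing (S b) a).
  replace (S a + S (S b))%nat with (S (S a + S b)) by lia.
  apply (Rmult_lt_reg_r (f (S b))); [apply f_pos|].
  assert (H0 := Rmult_lt_compat_l _ _ _ (f_pos 0) H).
  assert (Hb := Rmult_lt_compat_r _ _ _ (f_pos (S (S b))) IH).
  lra.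
Qed.

End StrictLogConcave.

Theorem theorem4p4 (f : nat -> R)
  (f_pos : forall n : nat, 0 < f n)
  (f0_ge1 : f 0%nat >= 1)
  (f_logconcave : forall n : nat, (0 < n)%nat ->
     f n ^ 2 > f (n - 1)%nat * f (n + 1)%nat) :
  forall a b : nat, (0 < a)%nat -> (0 < b)%nat -> f a * f b > f (a + b)%nat.
Proof.
intros [|a] [|b] Ha Hb; try lia.
assert (Hf : forall n, f n * f (S (S n)) < f (S n) * f (S n)).
{ intros n.
  assert (H := f_logconcave (S n) ltac:(lia)).
  replace (S n - 1)%nat with n in H by lia.
  replace (S n + 1)%nat with (S (S n)) in H by lia.
  lra. }
assert (H := strict_submultiplicative f f_pos Hf a b).
assert (H1 := Rmult_le_compat_r _ _ _
  (Rlt_le _ _ (f_pos (S a + S b)%nat)) (Rge_le _ _ f0_ge1)).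
lra.
Qed.
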